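(* Let $p>0$, let $\Omega\subset\mathbb{R}^n$ be Lebesgue measurable, let $\mu$ be Lebesgue measure, let $(E,\|\cdot\|)$ be a nonzero Banach space, and let $u:\Omega\to\mathbb{R}$ be $\mu$-measurable. Then $$\left\|\int_\Omega f\,d\mu\right\|^p\ge\int_\Omega u\,\|f\|^p\,d\mu\quad\text{for all } f\in L^1(\Omega\to E)$$ if and only if $u\le 0$ $\mu$-a.e. on $\Omega$.
   Context: $L^1(\Omega\to E)$ denotes the space of strongly (Bochner) measurable, Bochner integrable functions $f:\Omega\to E$; $\int_\Omega f\,d\mu$ is the Bochner integral. Saying the inequality holds for $f$ includes that $\int_\Omega u\|f\|^p\,d\mu$ is well defined as an extended real number in $[-\infty,\infty]$ (the value $-\infty$ is allowed). *)

(* Defs.v *)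
From HB Require Import structures.
From mathcomp Require Import all_boot all_order all_algebra.
From mathcomp Require Import all_classical all_reals all_analysis.
From mathcomp Require Import measurable_realfun.

Set Implicit Arguments.
Unset Strict Implicit.
Unset Printing Implicit Defensive.

Import Order.TTheory GRing.Theory Num.Theory.
Import numFieldNormedType.Exports.

Local Open Scope classical_set_scope.
Local Open Scope ring_scope.
Local Open Scope ereal_scope.

(* R^d with d >= 1 is 'rV[R]_n.+1, d = n.+1. Lebesgue measure is Caratheodory's
   restriction of the outer measure
     inf { \sum_k vol(B_k) | A is covered by the boxes B_k },
   so that the measurable sets are the Lebesgue (not only the Borel) ones. *)
Section lebesgue_measure_Rn.
Variables (R : realType) (n : nat).
Implicit Types (A : set 'rV[R]_n.+1) (b : 'rV[R]_n.+1 * 'rV[R]_n.+1).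

Definition box b : set 'rV[R]_n.+1 :=
  [set x | forall i, (b.1 ord0 i < x ord0 i <= b.2 ord0 i)%R].

(* the truncation at 0 gives volume 0 to the (empty) boxes with b.2 i <= b.1 i
   for some i *)
Definition box_volume b : R :=
  (\prod_i Num.max 0 (b.2 ord0 i - b.1 ord0 i))%R.

Definition box_cover A : set (nat -> 'rV[R]_n.+1 * 'rV[R]_n.+1) :=
  [set B | A `<=` \bigcup_k box (B k)].

Definition lebesgue_outer A : \bar R :=
  ereal_inf [set \sum_(k <oo) (box_volume (B k))%:E | B in box_cover A].

Let box_volume_ge0 b : 0 <= (box_volume b)%:E.
Proof.
by rewrite lee_fin; apply: prodr_ge0 => i _; rewrite le_max lexx.
Qed.

Let lebesgue_outer_ge0 A : 0 <= lebesgue_outer A.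
Proof.
apply: le_ereal_inf_tmp => _ [B _ <-].
by apply: nneseries_ge0 => k _ _; exact: box_volume_ge0.
Qed.

Let lebesgue_outer0 : lebesgue_outer set0 = 0.
Proof.
apply/eqP; rewrite eq_le lebesgue_outer_ge0 andbT.
apply: ereal_inf_lbound; exists (fun=> (0%R, 0%R)) => //=.
rewrite eseries0// => k _ _; congr EFin.
by rewrite /box_volume big_ord_recl/= subrr maxxx mul0r.
Qed.

Let le_lebesgue_outer :
  {homo lebesgue_outer : A B / A `<=` B >-> A <= B}.
Proof.
move=> A B AB; apply: ereal_inf_le_tmp => _ [C BC <-].
by exists C => //; exact: subset_trans AB BC.
Qed.

Let lebesgue_outer_sigma_subadditive : sigma_subadditive lebesgue_outer.
Proof.
move=> A; have [[i ioo]|] := pselect (exists i, lebesgue_outer (A i) = +oo).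
  rewrite (eseries_pinfty _ _ ioo) ?leey// => k _.
  by rewrite -ltNye (lt_le_trans _ (lebesgue_outer_ge0 _)).
rewrite -forallNE => Aoo; apply/lee_addgt0Pr => e e0.
rewrite (le_trans _ (epsilon_trick _ _ (ltW e0)))//.
pose P k B := box_cover (A k) B /\
  \sum_(j <oo) (box_volume (B j))%:E
    <= lebesgue_outer (A k) + (e / (2 ^ k.+1)%:R)%:E.
have [G PG] : {G & forall k, P k (G k)}.
  apply: (@choice _ _ P) => k.
  have ek : (0 < e / (2 ^ k.+1)%:R)%R by rewrite divr_gt0// ltr0n expn_gt0.
  have fA : lebesgue_outer (A k) \is a fin_num.
    by rewrite ge0_fin_numE// lt_neqAle leey andbT; exact/eqP/Aoo.
  have [_ [B AB <-] /ltW BA] := lb_ereal_inf_adherent ek fA.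
  by exists B.
pose v (p : nat * nat) := (box_volume (G p.1 p.2))%:E.
have v0 p : 0 <= v p by exact: box_volume_ge0.
apply: (@le_trans _ _ (\esum_(p in setT) v p)).
  have /card_esym/ppcard_eqP[f] := card_nat2.
  apply: ereal_inf_lbound; exists (fun k => G (f k).1 (f k).2).
    move=> x [i _ /(PG i).1[j _ Gx]].
    by exists (f^-1%FUN (i, j)) => //=; rewrite invK ?inE.
  rewrite nneseries_esumT//.
  by rewrite (reindex_esum [set: nat] [set: nat * nat] f v)//; exact: bij.
have -> : \esum_(p in setT) v p = \sum_(i <oo) \sum_(j <oo) v (i, j).
  rewrite nneseries_esumT; last by move=> i; exact: nneseries_ge0.
  under [RHS]eq_esum do rewrite nneseries_esumT//.
  rewrite esum_esum//.
  have -> : [set: nat] `*`` (fun=> [set: nat]) = [set: nat * nat].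
    by apply/seteqP; split.
  by apply: eq_esum => -[].
by apply: lee_nneseries => [i _ _|i _]; [exact: nneseries_ge0|exact: (PG i).2].
Qed.

HB.instance Definition _ := isOuterMeasure.Build R 'rV[R]_n.+1 lebesgue_outer
  lebesgue_outer0 lebesgue_outer_ge0 le_lebesgue_outer
  lebesgue_outer_sigma_subadditive.

Definition lebesgue_space := caratheodory_type lebesgue_outer.

HB.instance Definition _ := Measurable.on lebesgue_space.

Definition lebesgue_Rn (A : set lebesgue_space) : \bar R := lebesgue_outer A.

HB.instance Definition _ := isMeasure.Build _ lebesgue_space R lebesgue_Rn
  (@caratheodory_measure0 _ _ lebesgue_outer)
  (@caratheodory_measure_ge0 _ _ lebesgue_outer)
  (@caratheodory_measure_sigma_additive _ _ lebesgue_outer).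

End lebesgue_measure_Rn.

Arguments lebesgue_Rn : clear implicits.

Section bochner.
Context d (T : measurableType d) (R : realType) (E : completeNormedModType R).
Variables (mu : {measure set T -> \bar R}) (D : set T).
Implicit Types (f s : T -> E).

(* Functions are total on T; only their values on D matter. *)

Definition simple_fun s :=
  finite_set (s @` D) /\ forall y, measurable (D `&` s @^-1` [set y]).

Definition integrable_simple s :=
  simple_fun s /\ forall y, y != 0%R -> mu (D `&` s @^-1` [set y]) < +oo.

(* [fine] turns a possibly infinite measure of the level set of y = 0, whose
   contribution is 0, into a real number. *)
Definition simple_integral s : E :=
  (\sum_(y \in s @` D) fine (mu (D `&` s @^-1` [set y])) *: y)%R.

Definition strongly_measurable f := exists s_ : nat -> T -> E,
  (forall k, simple_fun (s_ k)) /\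
  {ae mu, forall x, D x -> s_ k x @[k --> \oo] --> f x}.

Definition bochner_approx f (s_ : nat -> T -> E) :=
  (forall k, integrable_simple (s_ k)) /\
  \int[mu]_(x in D) (`|f x - s_ k x|%R)%:E @[k --> \oo] --> 0.

Definition bochner_integrable f :=
  strongly_measurable f /\ exists s_ : nat -> T -> E, bochner_approx f s_.

(* For a Bochner integrable f this limit exists along every approximating
   sequence and does not depend on the sequence. *)
Definition bochner_integral f : E :=
  get [set v | exists2 s_ : nat -> T -> E, bochner_approx f s_ &
                 simple_integral (s_ k) @[k --> \oo] --> v].

End bochner.

(* [integral] is total (with +oo - +oo = -oo), whence this side condition. *)
Definition integral_well_defined d (T : measurableType d) (R : realType)
    (mu : {measure set T -> \bar R}) (D : set T) (g : T -> \bar R) :=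
  measurable_fun D g /\
  (\int[mu]_(x in D) g^\+ x < +oo \/ \int[mu]_(x in D) g^\- x < +oo).

(* Main.v *)
Require Import Defs.
From HB Require Import structures.
From mathcomp Require Import all_boot all_order all_algebra.
From mathcomp Require Import all_classical all_reals all_analysis.
From mathcomp Require Import measurable_realfun.
From mathcomp Require Import lra.
Import Order.TTheory GRing.Theory Num.Theory.
Import numFieldNormedType.Exports.
Local Open Scope classical_set_scope.
Local Open Scope ring_scope.

(* If u > 0 on a set of positive measure, that set contains disjoint B and C of
   finite positive measure, because Lebesgue measure has no atoms: arbitrarily
   small boxes of a countable grid cover the space. The function
   f = (mu C 1_B - mu B 1_C) e with e != 0 has integral 0, so the inequality
   forces the nonnegative function u |f|^p, positive on B, to vanish almost
   everywhere. Conversely, if u <= 0 a.e. the right-hand side is at most 0; what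
   has to be checked is that |f| is measurable, which follows from strong
   measurability since Lebesgue measure is complete. *)

Set Implicit Arguments.
Unset Strict Implicit.
Unset Printing Implicit Defensive.

(** * Boxes and non-atomicity of Lebesgue measure *)

Section lebesgue_boxes.
Variables (R : realType) (n : nat).
Local Notation mu := (lebesgue_Rn R n).
Local Notation space := (lebesgue_space R n).
Local Notation rowv := 'rV[R]_n.+1.
Implicit Types (b : rowv * rowv) (i : 'I_n.+1) (t : R).

Lemma box_volume_ge0 b : 0 <= box_volume b.
Proof. by apply: prodr_ge0 => i _; rewrite le_max lexx. Qed.

Definition set_coord (x : rowv) i t : rowv := \row_j if j == i then t else x ord0 j.

(** Cutting along the hyperplane at height [t] in direction [i] changes only the [i]-th factor.
    Truncation at 0 covers the case where the hyperplane misses the box. *)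
Lemma box_volume_split b i t :
  box_volume (set_coord b.1 i (Num.max (b.1 ord0 i) t), b.2)
  + box_volume (b.1, set_coord b.2 i (Num.min (b.2 ord0 i) t)) = box_volume b.
Proof.
rewrite /box_volume !(bigD1 (P := xpredT) i)//= !mxE !eqxx.
under eq_bigr => j ji do rewrite mxE (negbTE ji).
under [X in _ + _ * X]eq_bigr => j ji do rewrite mxE (negbTE ji).
rewrite -mulrDl; congr (_ * _).
move: (b.1 ord0 i) (b.2 ord0 i) => x y.
by case: (ltP x t) => ?; case: (ltP y t) => ?; do 3?case: ltP => ?; lra.
Qed.

(** Carathéodory's criterion: the hyperplane cuts any cover of [X] into covers of the two pieces of
    [X], with the same total volume. *)
Lemma measurable_halfspace i t : measurable [set x : space | t < x ord0 i].
Proof.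
set A := [set x | _]; apply: le_caratheodory_measurable => X /=.
apply: le_ereal_inf_tmp => _ [B XB <-].
pose B1 k := (set_coord (B k).1 i (Num.max ((B k).1 ord0 i) t), (B k).2).
pose B2 k := ((B k).1, set_coord (B k).2 i (Num.min ((B k).2 ord0 i) t)).
have -> : (\sum_(k <oo) (box_volume (B k))%:E =
    \sum_(k <oo) (box_volume (B1 k))%:E + \sum_(k <oo) (box_volume (B2 k))%:E)%E.
  rewrite -nneseriesD; try by move=> *; rewrite lee_fin box_volume_ge0.
  by apply: eq_eseriesr => k _; rewrite -EFinD box_volume_split.
apply: leeD; apply: ereal_inf_lbound.
- exists B1 => // x [/XB[k _ Bx] /= tx]; exists k => // j /=.
  rewrite mxE; case: eqVneq => [->|_]; last exact: Bx.
  by have /andP[h1 h2] := Bx i; rewrite gt_max h1 tx h2.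
- exists B2 => // x [/XB[k _ Bx] /= /negP]; rewrite -leNgt => tx.
  exists k => // j /=.
  rewrite mxE; case: eqVneq => [->|_]; last exact: Bx.
  by have /andP[h1 h2] := Bx i; rewrite le_min h1 h2 tx.
Qed.

Lemma measurable_box b : measurable (box b : set space).
Proof.
have -> : box b = \bigcap_(i in [set: 'I_n.+1])
    ([set x : space | b.1 ord0 i < x ord0 i] `&`
     ~` [set x : space | b.2 ord0 i < x ord0 i]).
  apply/seteqP; split => x h i.
    by move=> _; have /andP[h1 h2] := h i; split=> //=; apply/negP; rewrite -leNgt.
  by have [/= h1 /negP] := h i I; rewrite -leNgt h1.
apply: fin_bigcap_measurable => [|i _]; first exact: finite_finset.
by apply: measurableI; [|apply: measurableC]; exact: measurable_halfspace.
Qed.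

Lemma lebesgue_box_le b : (mu (box b) <= (box_volume b)%:E)%E.
Proof.
(* The cover is completed by copies of [(0, 0)], whose volume is 0. *)
pose B k := if k is 0%N then b else (0, 0) : rowv * rowv.
apply: ereal_inf_lbound; exists B; first by move=> x bx; exists 0%N.
rewrite nneseries_recl//; last by move=> k _; rewrite lee_fin box_volume_ge0.
rewrite [X in (_ + X)%E]eseries0 ?adde0// => -[|k]// _ _.
by rewrite /box_volume big_ord_recl/= subrr maxxx mul0r.
Qed.

(** Otherwise [A] would be a countable union of null sets, its intersections with the cubes [Q z] of
    a grid of mesh [e]. The bound [e <= 1] makes the volume [e ^ n.+1] of a cube at most [e]. *)
Lemma positive_measure_small_box (A : set space) (e : R) :
  measurable A -> (0 < mu A)%E -> 0 < e <= 1 ->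
  exists2 b, box_volume b <= e & (0 < mu (A `&` box b))%E.
Proof.
move=> mA A0 /andP[e0 e1].
pose Q (z : 'rV[int]_n.+1) : rowv * rowv :=
  (\row_j (e * (z ord0 j)%:~R), \row_j (e * (z ord0 j + 1)%:~R)).
apply: contrapT => /forall2NP nQ.
have Qe z : box_volume (Q z) <= e.
  rewrite /box_volume (eq_bigr (fun=> e)); last first.
    move=> i _; rewrite !mxE -mulrBr -intrB addrAC subrr add0r mulr1.
    by rewrite max_r// ltW.
  by rewrite prodr_const card_ord exprS ler_piMr ?(ltW e0)// exprn_ile1// ltW.
have {nQ Qe}Q0 z : mu (A `&` box (Q z)) = 0.
  apply/eqP; have [//|/negP] := nQ (Q z).
  by rewrite lt0e measure_ge0 andbT negbK.
pose F k := if (unpickle k : option 'rV[int]_n.+1) is Some z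
  then A `&` box (Q z) else set0.
have nF : mu.-negligible (\bigcup_k F k).
  apply: negligible_bigcup => k; rewrite /F; case: unpickle => [z|].
    by apply/negligibleP; [apply: measurableI => //; exact: measurable_box|exact: Q0].
  exact: negligible_set0.
suff /negligibleS/(_ nF) : A `<=` \bigcup_k F k.
  by move/negligibleP => /(_ mA) Ae; rewrite Ae ltxx in A0.
(* The cubes are open on the left and closed on the right, hence the ceiling minus 1 rather than the
   floor. *)
move=> x Ax; pose z := \row_j (Num.ceil (x ord0 j / e) - 1).
exists (pickle z) => //; rewrite /F pickleK; split=> // i /=.
rewrite !mxE -ltr_pdivlMl// -ler_pdivrMl// subrK mulrC ceil_ge andbT.
exact: ceilB1_lt.
Qed.

(** A first box cuts [A] down to finite positive measure; a second, of volume at most half of that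
    measure, meets it in a positive amount and cannot exhaust it. *)
Lemma lebesgue_split (A : set space) : measurable A -> (0 < mu A)%E ->
  exists B C : set space, [/\ measurable B /\ measurable C,
    B `&` C = set0, B `|` C `<=` A, (0 < mu B < +oo)%E & (0 < mu C < +oo)%E].
Proof.
move=> mA A0.
have [b _ Ab0] := positive_measure_small_box mA A0
  (introT andP (conj ltr01 (lexx 1))).
set A' := A `&` box b in Ab0.
have mA' : measurable A' by apply: measurableI => //; exact: measurable_box.
have A'oo : (mu A' < +oo)%E.
  apply: le_lt_trans (ltry (box_volume b)).
  apply: le_trans (lebesgue_box_le b).
  by apply: le_measure; rewrite ?inE//; [exact: measurable_box|exact: subIsetr].
have A'f : mu A' \is a fin_num by rewrite ge0_fin_numE.
have a0 : 0 < fine (mu A') by rewrite fine_gt0// Ab0.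
pose e := Num.min 1 (fine (mu A') / 2).
have e01 : 0 < e <= 1.
  by rewrite /e lt_min ltr01 divr_gt0//= ge_min lexx.
have [c ce Ac0] := positive_measure_small_box mA' Ab0 e01.
have mB : measurable (A' `&` box c) by apply: measurableI => //; exact: measurable_box.
have mC : measurable (A' `\` box c) by apply: measurableD => //; exact: measurable_box.
have Boo : (mu (A' `&` box c) < mu A')%E.
  apply: (@le_lt_trans _ _ (mu (box c))).
    by apply: le_measure; rewrite ?inE//; exact: measurable_box.
  apply: (le_lt_trans (lebesgue_box_le c)).
  rewrite -(fineK A'f) lte_fin (le_lt_trans ce)//.
  rewrite (@le_lt_trans _ _ (fine (mu A') / 2))//.
    by rewrite /e ge_min lexx orbT.
  lra.
exists (A' `&` box c), (A' `\` box c); split => //.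
- by rewrite setDE setIACA setICr setI0.
- by move=> x [[[]]|[[]]].
- by rewrite Ac0 (lt_trans Boo).
- apply/andP; split; last first.
    by apply: le_lt_trans A'oo; apply: le_measure; rewrite ?inE//; exact: subDsetl.
  rewrite measureD//; last exact: measurable_box.
  by rewrite sube_gt0.
Qed.

End lebesgue_boxes.

(** * Functions with finitely many values, and sums over their levels *)

Section finite_levels.
Context d (T : measurableType d) (D : set T).
Context (W : choiceType) (g : T -> W).
Hypothesis mg : forall w, measurable (D `&` g @^-1` [set w]).

Lemma measurable_preimage_finite_levels (Y : set W) :
  finite_set (g @` D) -> measurable (D `&` g @^-1` Y).
Proof.
move=> fg; have -> : D `&` g @^-1` Y =
    \bigcup_(w in (g @` D) `&` Y) (D `&` g @^-1` [set w]).
  apply/seteqP; split => [x [Dx Yx]|x [w [_ Yw] [Dx /= gx]]].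
    by exists (g x) => //; split => //; exists x.
  by split => //=; rewrite gx.
by apply: fin_bigcup_measurable => //; exact: finite_setIl.
Qed.

Lemma measurable_fun_finite_levels d' (V : measurableType d') (h : W -> V) :
  finite_set (g @` D) -> measurable_fun D (h \o g).
Proof.
by move=> fg _ Y _; exact: (measurable_preimage_finite_levels (h @^-1` Y)).
Qed.

End finite_levels.

Section simple_sums.
Context d (T : measurableType d) (R : realType) (E : completeNormedModType R).
Variables (mu : {measure set T -> \bar R}) (D : set T).
Context (W : choiceType) (g : T -> W) (s : seq W).
Local Notation level w := (D `&` g @^-1` [set w]).
Hypotheses (us : uniq s) (gs : forall x, D x -> g x \in s).
Hypothesis mg : forall w, measurable (level w).

Let trivIset_level (A : set W) : trivIset A (fun w => level w).
Proof. by move=> w w' _ _ [x [[_ /= <-] [_ /= <-]]]. Qed.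

(** The levels of [g] may be finer than those of [phi \o g], and [s] may list values not taken.
    Grouping the levels by the value of [phi] and using finite additivity gives the simple
    integral. *)
Lemma simple_integral_comp (phi : W -> E) :
  (forall w, phi w != 0 -> (mu (level w) < +oo)%E) ->
  simple_integral mu D (phi \o g) = \sum_(w <- s) fine (mu (level w)) *: phi w.
Proof.
move=> phioo; pose t := undup (map phi s).
have level_phi y : mu (D `&` (phi \o g) @^-1` [set y]) =
    (\sum_(w <- s | phi w == y) mu (level w))%E.
  rewrite -big_filter fsbig_seq ?filter_uniq// -measure_fin_bigcup//.
    congr (mu _); apply/seteqP; split => [x [Dx /= gx]|x [w]].
      by exists (g x) => //=; rewrite mem_filter gx eqxx gs.
    by rewrite /= mem_filter => /andP[/eqP <- _] [Dx /= ->].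
rewrite /simple_integral (fsbig_fwiden t) ?undup_uniq//; last 2 first.
- by move=> _ [x Dx <-]; rewrite /= mem_undup map_f// gs.
- move=> y [_ /= ny]; rewrite [X in mu X](_ : _ = set0) ?measure0 ?scale0r//.
  by apply/seteqP; split=> // x [Dx /= gx]; apply: ny; exists x.
transitivity (\sum_(y <- t) \sum_(w <- s | phi w == y)
    fine (mu (level w)) *: phi w).
  (* For [y = 0] both sides vanish, whatever the measures; otherwise the levels have finite measure,
     so [fine] commutes with the sum. *)
  apply: eq_bigr => y _; have [->|y0] := eqVneq y 0.
    by rewrite scaler0 big1// => w /eqP ->; rewrite scaler0.
  rewrite level_phi -sum_fine; last first.
    by move=> w /eqP wy; rewrite ge0_fin_numE// phioo// wy.
  by rewrite scaler_suml; apply: eq_bigr => w /eqP ->.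
(* After the exchange each [w] meets exactly one [y], namely [phi w], which occurs once in [t]. *)
rewrite (exchange_big_dep xpredT)//= [LHS]big_seq [RHS]big_seq.
apply: eq_bigr => w ws; rewrite (eq_bigl (pred1 (phi w))); last first.
  by move=> y; rewrite /= eq_sym.
by rewrite big_const_seq count_uniq_mem ?undup_uniq// mem_undup map_f//= addr0.
Qed.

(** [D] is the disjoint union of the levels listed by [s], and the integrand is constant on each. *)
Lemma integral_finite_levels (psi : W -> R) : (forall w, 0 <= psi w) ->
  (\int[mu]_(x in D) (psi (g x))%:E = \sum_(w <- s) (psi w)%:E * mu (level w))%E.
Proof.
move=> psi0.
have DE : D = \big[setU/set0]_(w <- s) (level w).
  rewrite big_seq_cond -bigcup_seq_cond; apply/seteqP; split=> [x Dx|x [w _ []]//].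
  by exists (g x); rewrite //= andbT gs.
have fin_gD : finite_set (g @` D).
  by apply: (sub_finite_set _ (finite_seq s)) => _ [x Dx <-] /=; exact: gs.
rewrite [X in integral _ X _]DE ge0_integral_bigsetU//=; last 2 first.
- by rewrite -DE; exact: (measurable_fun_finite_levels mg (fun w => (psi w)%:E)).
- by move=> x _; rewrite lee_fin.
apply: eq_bigr => w _; rewrite -integral_cst//.
by apply: eq_integral => x; rewrite inE => -[_ /= ->].
Qed.

End simple_sums.

(** * The Bochner integral of simple functions *)

Section simple_bochner_integral.
Context d (T : measurableType d) (R : realType) (E : completeNormedModType R).
Variables (mu : {measure set T -> \bar R}) (D : set T) (mD : measurable D).
Implicit Types s f : T -> E.

(* Both integrals are computed over the common refinement given by the levels of
   x |-> (s x, f x). *)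
Lemma simple_integral_dist s f :
  integrable_simple mu D s -> integrable_simple mu D f ->
  ((`|simple_integral mu D s - simple_integral mu D f|)%:E
    <= \int[mu]_(x in D) (`|f x - s x|)%:E)%E.
Proof.
move=> [[/finite_seqP[a sa] ms] soo] [[/finite_seqP[b fb] mf] foo].
pose g x := (s x, f x).
pose ab := undup [seq (y, z) | y <- a, z <- b].
have gab x : D x -> g x \in ab.
  move=> Dx; rewrite mem_undup; apply: allpairs_f.
    by have : (s @` D) (s x) by [exists x]; rewrite sa.
  by have : (f @` D) (f x) by [exists x]; rewrite fb.
have levelE w : D `&` g @^-1` [set w] =
    (D `&` s @^-1` [set w.1]) `&` (D `&` f @^-1` [set w.2]).
  case: w => y z; apply/seteqP; split => [x [Dx [<- <-]]//|x [[Dx /= sx] [_ /= fx]]].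
  by split => //; rewrite /g /= sx fx.
have mg w : measurable (D `&` g @^-1` [set w]).
  by rewrite levelE; exact: measurableI.
have goo1 w : w.1 != 0 -> (mu (D `&` g @^-1` [set w]) < +oo)%E.
  move/soo; apply: le_lt_trans; apply: le_measure; rewrite ?inE//.
  by rewrite levelE; exact: subIsetl.
have goo2 w : w.2 != 0 -> (mu (D `&` g @^-1` [set w]) < +oo)%E.
  move/foo; apply: le_lt_trans; apply: le_measure; rewrite ?inE//.
  by rewrite levelE; exact: subIsetr.
have uab : uniq ab by exact: undup_uniq.
rewrite (_ : simple_integral mu D s = simple_integral mu D (fst \o g))//.
rewrite (_ : simple_integral mu D f = simple_integral mu D (snd \o g))//.
rewrite (simple_integral_comp uab gab mg goo1) (simple_integral_comp uab gab mg goo2).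
rewrite (integral_finite_levels mu uab gab mg (psi := fun w => `|w.2 - w.1|))//.
rewrite -sumrB; apply: (@le_trans _ _ (\sum_(w <- ab)
    `|fine (mu (D `&` g @^-1` [set w])) *: (w.1 - w.2)|)%:E).
  by rewrite lee_fin; under eq_bigr do rewrite -scalerBr; exact: ler_norm_sum.
rewrite -sumEFin; apply: lee_sum => w _; rewrite normrZ distrC.
(* A level with [w.1 = w.2] may have infinite measure but contributes 0; otherwise one component is
   nonzero and the measure is finite. *)
have [->|w12] := eqVneq w.1 w.2; first by rewrite subrr normr0 mulr0 mul0e.
rewrite muleC EFinM ger0_norm ?fine_ge0// fineK// ge0_fin_numE//.
have [w10|/goo1//] := eqVneq w.1 0.
by apply: goo2; rewrite -w10 eq_sym.
Qed.

Lemma simple_bochner_approx f : integrable_simple mu D f ->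
  bochner_approx mu D f (fun=> f).
Proof.
move=> fi; split => //.
under eq_fun do under eq_integral do rewrite subrr normr0.
by rewrite integral0; exact: cvg_cst.
Qed.

Lemma simple_bochner_integrable f : integrable_simple mu D f ->
  bochner_integrable mu D f.
Proof.
move=> fi; split; last by exists (fun=> f); exact: simple_bochner_approx.
exists (fun=> f); split => [k|]; first exact: fi.1.
by apply: aeW => x _; exact: cvg_cst.
Qed.

(** The constant sequence shows that [get] selects a genuine limit. Along whichever sequence it
    comes from, [simple_integral_dist] forces the limit to be the simple integral of [f]. *)
Lemma simple_bochner_integral f : integrable_simple mu D f ->
  bochner_integral mu D f = simple_integral mu D f.
Proof.
move=> fi; rewrite /bochner_integral; set P := [set v | _].
have : P (get P).
  apply: getPex; exists (simple_integral mu D f), (fun=> f).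
    exact: simple_bochner_approx.
  exact: cvg_cst.
case=> s_ [si s0] sv; apply: (cvg_unique _ sv) => //.
have d0 : (`|simple_integral mu D (s_ k) - simple_integral mu D f|)%:E
    @[k --> \oo] --> 0%E.
  apply: (squeeze_cvge _ (cvg_cst _) s0); apply: nearW => k.
  by rewrite lee_fin normr_ge0 simple_integral_dist.
apply: (cvg_sub0 _ (cvg_cst _)); apply: norm_cvg0.
exact: (fine_cvg d0).
Qed.

Lemma exists_mean_zero (B C : set T) : (exists e : E, e != 0) ->
  measurable B -> measurable C -> B `&` C = set0 -> B `|` C `<=` D ->
  (0 < mu B < +oo)%E -> (0 < mu C < +oo)%E ->
  exists f, [/\ bochner_integrable mu D f, bochner_integral mu D f = 0,
    forall x, (B `|` C) x -> f x != 0 & forall x, ~ (B `|` C) x -> f x = 0].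
Proof.
move=> [e e0] mB mC BC BCD /andP[B0 Boo] /andP[C0 Coo].
(* The function is [phi \o g], where [g] labels [B], [C] and the rest. Working with labels avoids
   computing the levels of the vector values themselves. *)
pose g x := if x \in B then Some true else if x \in C then Some false else None.
pose phi (w : option bool) : E := match w with
  | Some true => fine (mu C) *: e
  | Some false => - (fine (mu B) *: e)
  | None => 0
  end.
pose values := [:: None; Some true; Some false].
have gvalues x : D x -> g x \in values.
  by move=> _; rewrite /g; case: ifP => _ //; case: ifP.
have levelB : D `&` g @^-1` [set Some true] = B.
  apply/seteqP; split => [x [_ /=]|x Bx].
    by rewrite /g; case: ifP => [/set_mem//|_]; case: ifP.
  by split; [apply: BCD; left|rewrite /g /= mem_set].
have levelC : D `&` g @^-1` [set Some false] = C.
  apply/seteqP; split => [x [_ /=]|x Cx].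
    by rewrite /g; case: ifP => // _; case: ifP => [/set_mem//|].
  split; [by apply: BCD; right|rewrite /g /= (mem_set Cx)].
  by case: ifPn => // /set_mem Bx; have : set0 x by rewrite -BC.
have levelN : D `&` g @^-1` [set None] = D `\` (B `|` C).
  apply/seteqP; split => x [Dx /=].
    rewrite /g; case: ifPn => // /negP nB; case: ifPn => // /negP nC _.
    by split => // -[] /mem_set.
  move=> nBC; split => //=; rewrite /g; case: ifPn => [/set_mem Bx|_].
    by exfalso; apply: nBC; left.
  by case: ifPn => // /set_mem Cx; exfalso; apply: nBC; right.
have mg w : measurable (D `&` g @^-1` [set w]).
  case: w => [[]|]; rewrite ?levelB ?levelC ?levelN//.
  by apply: measurableD => //; exact: measurableU.
have goo w : phi w != 0 -> (mu (D `&` g @^-1` [set w]) < +oo)%E.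
  by case: w => [[]|]; rewrite ?levelB ?levelC//= eqxx.
have fi : integrable_simple mu D (phi \o g).
  have fg : finite_set (g @` D) by exact: finite_finset.
  split; first split => [|y].
  - by rewrite -image_comp; exact: finite_image.
  - exact: (measurable_preimage_finite_levels mg (phi @^-1` [set y])).
  (* The level of [None] may have infinite measure; a nonzero value is taken only inside [B] and
     [C]. *)
  move=> y y0; apply: (@le_lt_trans _ _ (mu (B `|` C))).
    apply: le_measure; rewrite ?inE//.
    - exact: (measurable_preimage_finite_levels mg (phi @^-1` [set y])).
    - exact: measurableU.
    move=> x [Dx /= gx]; apply: contrapT => nBC.
    move: y0; rewrite -gx; have [_ ->] : (D `&` g @^-1` [set None]) x.
      by rewrite levelN.
    by rewrite /= eqxx.
  by rewrite measureU// lte_add_pinfty.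
have fB0 : 0 < fine (mu B) by rewrite fine_gt0// B0.
have fC0 : 0 < fine (mu C) by rewrite fine_gt0// C0.
exists (phi \o g); split.
- exact: simple_bochner_integrable.
- rewrite simple_bochner_integral//.
  rewrite (simple_integral_comp (s := values) _ gvalues mg goo)//.
  rewrite !big_cons big_nil levelB levelC /= scaler0 add0r addr0 scalerN !scalerA.
  by rewrite mulrC subrr.
- move=> x BCx; have : (D `&` g @^-1` [set None]) x -> False.
    by rewrite levelN => -[].
  rewrite /=; case: (g x) (BCD _ BCx) => [[]|] /=.
  - by move=> *; rewrite scaler_eq0 negb_or gt_eqF.
  - by move=> *; rewrite oppr_eq0 scaler_eq0 negb_or gt_eqF.
  - by move=> Dx /(_ (conj Dx erefl)).
- move=> x nBC /=; rewrite /g; case: ifPn => [/set_mem Bx|_].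
    by exfalso; apply: nBC; left.
  by case: ifPn => // /set_mem Cx; exfalso; apply: nBC; right.
Qed.

End simple_bochner_integral.

(** Off a null set [N] the norm is a pointwise limit of norms of simple functions; inside [N] every
    set is measurable by completeness. *)
Lemma measurable_norm_strongly_measurable d (T : measurableType d)
    (R : realType) (E : completeNormedModType R) (mu : {measure set T -> \bar R})
    (D : set T) (f : T -> E) :
  measure_is_complete mu -> measurable D -> strongly_measurable mu D f ->
  measurable_fun D (fun x => `|f x|).
Proof.
move=> cmu mD [s_ [ss [N [mN N0 sN]]]].
have DE : D = (D `\` N) `|` (D `&` N) by rewrite setUC setUIDK.
have mDN : measurable (D `\` N) by exact: measurableD.
rewrite DE; apply/measurable_funU => //; first exact: measurableI.
split.
- apply: (@measurable_fun_cvg _ _ _ _ (fun k x => `|s_ k x|)).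
    move=> k; apply: (@measurable_funS _ _ _ _ D) => //.
    have [fk mk] := ss k.
    exact: (measurable_fun_finite_levels mk (fun y => `|y| : R) fk).
  move=> x [Dx Nx]; apply: cvg_norm; apply: contrapT => ncv.
  by apply: Nx; apply: sN => /= /(_ Dx).
- move=> _ Y _; apply: cmu; exists N; split => //.
  by move=> x [[]].
Qed.

Theorem theorem2p2 (R : realType) (p : R) (hp : 0 < p) (n : nat)
    (Omega : set (lebesgue_space R n)) (mOmega : measurable Omega)
    (E : completeNormedModType R) (hE : exists e : E, e != 0)
    (u : lebesgue_space R n -> R) (mu_u : measurable_fun Omega u) :
  (forall f : lebesgue_space R n -> E,
     bochner_integrable (lebesgue_Rn R n) Omega f ->
     integral_well_defined (lebesgue_Rn R n) Omega
       (fun x => (u x * `|f x| `^ p)%:E) /\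
     (\int[lebesgue_Rn R n]_(x in Omega) (u x * `|f x| `^ p)%:E
       <= (`|bochner_integral (lebesgue_Rn R n) Omega f| `^ p)%:E)%E) <->
  {ae lebesgue_Rn R n, forall x, Omega x -> u x <= 0}.
Proof.
pose mu : {measure set (lebesgue_space R n) -> \bar R} := lebesgue_Rn R n.
have cmu : measure_is_complete mu.
  exact: (@measure_is_complete_caratheodory R 'rV[R]_n.+1 (@lebesgue_outer R n)).
split => [ineq|u_le0 f [sf _]].
- pose P := Omega `&` u @^-1` `]0, +oo[.
  have mP : measurable P by apply: mu_u => //; exact: measurable_itv.
  have [P0|] := eqVneq (mu P) 0%E.
    exists P; split => // x /= /not_implyP[Ox /negP].
    by rewrite -ltNge => ux; split => //=; rewrite in_itv /= ux.
  rewrite -measure_gt0 => /(lebesgue_split mP)[B [C [[mB mC] BC BCP B0 C0]]].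
  have BCO : B `|` C `<=` Omega by move=> x /BCP[].
  have [f [fi f0 fBC fN]] := exists_mean_zero mOmega hE mB mC BC BCO B0 C0.
  have [[mg _]] := ineq f fi.
  (* Here [p != 0] matters, as the power of 0 with exponent 0 is 1. *)
  rewrite f0 normr0 powR0 ?gt_eqF// => le0.
  set g := fun x => _ in mg le0.
  (* On [B] and [C] the factor [u] is positive; elsewhere [f] vanishes. *)
  have g0 x : Omega x -> (0 <= g x)%E.
    move=> Ox; rewrite lee_fin; have [/BCP[_ /=]|/fN ->] := pselect ((B `|` C) x).
      by rewrite in_itv /= andbT => /ltW ux; rewrite mulr_ge0// powR_ge0.
    by rewrite normr0 powR0 ?gt_eqF// mulr0.
  have : (\int[mu]_(x in Omega) `|g x| = 0)%E.
    apply/eqP; rewrite eq_le integral_ge0// andbT (le_trans _ le0)//.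
    rewrite le_eqVlt; apply/orP; left; apply/eqP/eq_integral => x /set_mem Ox.
    by rewrite gee0_abs ?g0.
  move/(ae_eq_integral_abs mu mOmega mg) => g_eq0.
  (* On [B] both [u] and the norm of [f] are positive, so [B] lies in the exceptional set where [g]
     is nonzero. *)
  have : mu.-negligible B.
    apply: negligibleS g_eq0 => x Bx /=.
    have BCx : (B `|` C) x by left.
    move/(_ (BCO _ BCx)) => [] /eqP; rewrite mulf_eq0 powR_eq0 normr_eq0.
    rewrite (negbTE (fBC _ BCx)) /= orbF => /eqP u0.
    by have [_ /=] := BCP _ BCx; rewrite in_itv /= u0 ltxx.
  by move/(negligibleP mu mB) => muB; rewrite muB ltxx in B0.
- set g := fun x => _.
  have mg : measurable_fun Omega g.
    apply/measurable_EFinP; apply: measurable_funM => //.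
    apply: (@measurableT_comp _ _ _ _ _ _ (fun r : R => r `^ p) _ (fun x => `|f x|)).
      exact: measurable_powR.
    exact: measurable_norm_strongly_measurable cmu mOmega sf.
  (* The vanishing positive part gives both well-definedness and the bound: the integral is minus
     that of [g^\-], possibly [-oo]. *)
  have gp0 : (\int[mu]_(x in Omega) g^\+ x = 0)%E.
    rewrite (ge0_ae_eq_integral (g := cst 0%E))//.
    + by rewrite integral0.
    + exact: measurable_funepos.
    apply: filterS u_le0 => x ux Ox.
    rewrite funeposE /= max_r// lee_fin mulr_le0_ge0// ?powR_ge0//.
    exact: ux.
  split; first by split => //; left; rewrite gp0.
  rewrite integralE gp0 sub0e; apply: (@le_trans _ _ 0%E).
    by rewrite oppe_le0 integral_ge0.
  by rewrite lee_fin powR_ge0.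
Qed.
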